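(* Let $\mathfrak{A}$ be a unital $C^*$-algebra, $a\in\mathfrak{A}$, and let $h_a^{\mathfrak{A}}:W_{\mathfrak{A}}(a)\to\mathbb{R}$ be the height function $h_a^{\mathfrak{A}}(\mu)=\sup\mathscr{L}_{\mu}^{\mathfrak{A}}(a)$. Then on $W_{\mathfrak{A}}(a)$: (i) $h_a^{\mathfrak{A}}$ is non-negative. (ii) $h_a^{\mathfrak{A}}$ is concave. (iii) $h_a^{\mathfrak{A}}$ is upper semi-continuous.
   Context: $\mathfrak{A}$ is a complex, nonzero, unital $C^*$-algebra with unit $\boldsymbol{1}$; its state space $\mathfrak{S}(\mathfrak{A})$ is the set of all positive linear functionals $f\in\mathfrak{A}^*$ with $\|f\|=f(\boldsymbol{1})=1$. For $a\in\mathfrak{A}$: $W_{\mathfrak{A}}(a)=\{f(a):f\in\mathfrak{S}(\mathfrak{A})\}$ (a nonempty compact convex subset of $\mathbb{C}$); $DW_{\mathfrak{A}}(a)=\{(f(a),f(a^*a)):f\in\mathfrak{S}(\mathfrak{A})\}\subset\mathbb{C}\times\mathbb{R}$; and for $\mu\in W_{\mathfrak{A}}(a)$, $\mathscr{L}_{\mu}^{\mathfrak{A}}(a)=\{r:(\mu,r)\in DW_{\mathfrak{A}}(a)\}\subseteq[0,\|a\|^2]$. *)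

(* Defs.v *)
From HB Require Import structures.
From mathcomp Require Import all_boot all_order all_algebra.
From mathcomp Require Import complex.
From mathcomp Require Import all_classical all_reals all_analysis.

Set Implicit Arguments.
Unset Strict Implicit.
Unset Printing Implicit Defensive.

Import Order.TTheory GRing.Theory Num.Theory.
Import numFieldNormedType.Exports.

Local Open Scope classical_set_scope.
Local Open Scope ring_scope.
Local Open Scope complex_scope.

(* [numFieldNormedType.Exports] gives normed-module structures to variables
   [K : numClosedFieldType] only; [R[i]] has its own head constant. *)
#[non_forgetful_inheritance]
HB.instance Definition _ (R : realType) := NormedModule.copy R[i] R[i]^o.

(* MathComp-Analysis has no structure that is both a ring and a normed module,
   and Hierarchy Builder cannot add that join after [Num.NumDomain].  The norm
   is therefore a separate operation [anorm], and the library's norm and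
   topology are put on the alias [normed_of A]. *)
HB.mixin Record hasAlgebraNorm (R : realType) A & GRing.Algebra R[i] A := {
  anorm : A -> R;
  anormD : forall x y : A, anorm (x + y) <= anorm x + anorm y;
  anormZ : forall (c : R[i]) (x : A), (anorm (c *: x))%:C = `|c| * (anorm x)%:C;
  anorm0_eq0 : forall x : A, anorm x = 0 -> x = 0;
  anormM : forall x y : A, anorm (x * y) <= anorm x * anorm y
}.

#[short(type="normedAlgType")]
HB.structure Definition NormedAlgebra (R : realType) :=
  {A of GRing.Algebra R[i] A & hasAlgebraNorm R A}.

Definition normed_of (R : realType) (A : normedAlgType R) : Type := A.

Section normed_of.
Context {R : realType} {A : normedAlgType R}.
Local Notation V := (normed_of A).

HB.instance Definition _ := GRing.Lmodule.copy V A.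

Let norm (x : V) : R[i] := (anorm (x : A))%:C.

Let normD (x y : V) : norm (x + y) <= norm x + norm y.
Proof. by rewrite /norm -rmorphD lecR; exact: anormD. Qed.

Let normZ (c : R[i]) (x : V) : norm (c *: x) = `|c| * norm x.
Proof. exact: (@anormZ R A). Qed.

Let norm0_eq0 (x : V) : norm x = 0 -> x = 0.
Proof. by move=> [] /(@anorm0_eq0 R A). Qed.

HB.instance Definition _ :=
  Lmodule_isNormed.Build R[i] V normD normZ norm0_eq0.
End normed_of.

(* The unit and its being nonzero come from [algType]. *)
HB.mixin Record isCStarAlgebra (R : realType) A & NormedAlgebra R A := {
  star : A -> A;
  starK : involutive star;
  starD : {morph star : x y / x + y};
  starZ : forall (c : R[i]) (x : A), star (c *: x) = c^* *: star x;
  starM : forall x y : A, star (x * y) = star y * star x;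
  anorm_starM : forall x : A, anorm (star x * x) = anorm x ^+ 2;
  anorm_complete : forall F : set_system (normed_of A),
    ProperFilter F -> cauchy F -> cvg F
}.

#[short(type="cstarAlgType")]
HB.structure Definition CStarAlgebra (R : realType) :=
  {A of NormedAlgebra R A & isCStarAlgebra R A}.

Section numerical_range.
Context {R : realType} {A : cstarAlgType R}.
Implicit Types (f : {scalar A}) (a : A) (mu : R[i]).

Definition dual_norm f : R :=
  sup [set Normc.normc (f x) | x in [set x : A | anorm x <= 1]].

(* The order on [R[i]] makes [0 <= z] say that z is real and non-negative. *)
Definition positive_functional f := forall x : A, 0 <= f (star x * x).

(* Continuity puts f in the topological dual, so that the supremum defining
   [dual_norm f] is over a bounded set. *)
Definition states : set {scalar A} := [set f : {scalar A} |
  [/\ continuous (fun x : normed_of A => f x), positive_functional f,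
      dual_norm f = 1 & f 1 = 1]].

(* Algebraic numerical range and Davis-Wielandt shell. *)
Definition W a : set R[i] := [set f a | f in states].

Definition DW a : set (R[i] * R) :=
  [set p | exists2 f, states f & f a = p.1 /\ f (star a * a) = p.2%:C].

Definition Lset a mu : set R := [set r | DW a (mu, r)].

(* For mu in [W a] the set is nonempty and contained in [0, anorm a ^+ 2], so
   [sup] is a genuine supremum; off [W a] the value 0 is junk. *)
Definition height a mu : R := sup (Lset a mu).

End numerical_range.

Section functions_on_complex_sets.
Context {R : realType}.
Implicit Types (D : set R[i]) (h : R[i] -> R).

(* Convexity of the domain D is part of being concave on D. *)
Definition concave_on D h := forall (x y : R[i]) (t : R),
  D x -> D y -> 0 <= t <= 1 ->
  let z := t%:C * x + (1 - t)%:C * y in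
  D z /\ t * h x + (1 - t) * h y <= h z.

Definition upper_semicontinuous_on D h := forall (x : R[i]) (c : R),
  D x -> h x < c -> \forall y \near within D (nbhs x), h y < c.

End functions_on_complex_sets.

(* Main.v *)
(* The convex combination of two states is a state, which makes the height
   concave.  For upper semicontinuity, suppose that there are states f with
   f(a) arbitrarily close to mu and f(a^* a) >= c'.  By weak* compactness they
   accumulate at a state g with g(a) = mu and g(a^* a) >= c', so the height at
   mu is at least c'. *)

From HB Require Import structures.
Require Import Defs.
From mathcomp Require Import all_boot all_order all_algebra.
From mathcomp Require Import complex.
From mathcomp Require Import all_classical all_reals all_analysis.
From mathcomp Require Import ring lra.

Local Open Scope ring_scope.

Import Order.TTheory GRing.Theory Num.Theory.
Import numFieldNormedType.Exports.
Local Open Scope classical_set_scope.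
Local Open Scope complex_scope.

(** If [B] lies in a finer filter [G] while its preimage is not in [F], the complement of that
    preimage is in [F]; then [G] contains both [B] and its complement, which is absurd. *)
Lemma ultra_fmap (T U : Type) (f : T -> U) (F : set_system T) :
  UltraFilter F -> UltraFilter (f @ F).
Proof.
move=> UF; have PF : ProperFilter F := @ultra_proper _ _ UF; split=> [|G PG FG].
  exact: fmap_proper_filter.
rewrite predeqE => B; split; last exact: FG.
move=> GB; have [//|FnB] := in_ultra_setVsetC (f @^-1` B) UF.
by have [y []] := filter_ex (filterI GB (FG (~` B) FnB)).
Qed.

(** * Real part, imaginary part and modulus *)

Section complex_components.
Set Implicit Arguments.
Unset Strict Implicit.
Context {R : realType}.
Implicit Types z : R[i].

Lemma normc_normr z : `|z| = (Normc.normc z)%:C.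
Proof. by rewrite normc_def; case: z. Qed.

Lemma normc_sqr z : Normc.normc z ^+ 2 = complex.Re z ^+ 2 + complex.Im z ^+ 2.
Proof. by case: z => x y /=; rewrite sqr_sqrtr // addr_ge0 // sqr_ge0. Qed.

Lemma normc_ge0 z : 0 <= Normc.normc z.
Proof. by case: z => x y /=; exact: sqrtr_ge0. Qed.

Lemma normr_Re_le_normc z : `|complex.Re z| <= Normc.normc z.
Proof.
rewrite -(@ler_pXn2r _ 2) ?nnegrE ?normc_ge0// normc_sqr.
by rewrite real_normK ?num_real// lerDl sqr_ge0.
Qed.

Lemma normr_Im_le_normc z : `|complex.Im z| <= Normc.normc z.
Proof.
rewrite -(@ler_pXn2r _ 2) ?nnegrE ?normc_ge0// normc_sqr.
by rewrite real_normK ?num_real// lerDr sqr_ge0.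
Qed.

Lemma normc_real (x : R) : 0 <= x -> Normc.normc x%:C = x.
Proof. by move=> x0 /=; rewrite expr0n/= addr0 sqrtr_sqr ger0_norm. Qed.

Lemma ReD z1 z2 : complex.Re (z1 + z2) = complex.Re z1 + complex.Re z2.
Proof. by case: z1 z2 => [? ?] [? ?]. Qed.

Lemma ImD z1 z2 : complex.Im (z1 + z2) = complex.Im z1 + complex.Im z2.
Proof. by case: z1 z2 => [? ?] [? ?]. Qed.

Lemma ReM z1 z2 : complex.Re (z1 * z2) =
  complex.Re z1 * complex.Re z2 - complex.Im z1 * complex.Im z2.
Proof. by case: z1 z2 => [? ?] [? ?]. Qed.

Lemma ImM z1 z2 : complex.Im (z1 * z2) =
  complex.Re z1 * complex.Im z2 + complex.Im z1 * complex.Re z2.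
Proof. by case: z1 z2 => [? ?] [? ?]. Qed.

End complex_components.

(** * States: norm bound, convexity, weak* compactness *)

Section states.
Set Implicit Arguments.
Unset Strict Implicit.
Context {R : realType} {A : cstarAlgType R}.
Implicit Types (f g : {scalar A}) (a x : A).

Lemma anorm_ge0 x : 0 <= anorm x.
Proof.
have := normr_ge0 (x : normed_of A).
by rewrite [leRHS](_ : _ = (anorm x)%:C)// ler0c.
Qed.

(** The unit is self-adjoint, so the C*-identity makes its norm equal to its own square; the norm is
    nonzero because [1 != 0]. *)
Lemma anorm1 : anorm (1 : A) = 1.
Proof.
have star1 : star (1 : A) = 1.
  by have := starM (star (1 : A)) 1; rewrite mulr1 starK mulr1.
have := anorm_starM (1 : A); rewrite star1 mulr1 => /eqP.
rewrite -subr_eq0 expr2 -{1}(mulr1 (anorm 1)) -mulrBr mulf_eq0.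
move=> /orP[/eqP/anorm0_eq0/eqP|].
  by rewrite oner_eq0.
by rewrite subr_eq0 => /eqP.
Qed.

Lemma state_bound f x : states f -> Normc.normc (f x) <= anorm x.
Proof.
move=> [_ _ df1 _].
have [x0|x0] := eqVneq (anorm x) 0.
  by rewrite x0 (anorm0_eq0 _ x0) linear0 Normc.normc0.
have xp : 0 < anorm x by rewrite lt_def x0 anorm_ge0.
(* [sup] takes the default value 0 where no supremum exists, so [dual_norm f = 1] forces boundedness
   on the unit ball. *)
have hs : has_sup [set Normc.normc (f x) | x in [set x : A | anorm x <= 1]].
  by apply: contrapT => /sup_out; rewrite [sup _]df1 => /eqP; rewrite oner_eq0.
have : Normc.normc (f ((anorm x)^-1%:C *: x)) <= 1.
  rewrite -[leRHS]df1; apply: sup_upper_bound => //; eexists; last reflexivity.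
  rewrite /= -lecR anormZ normc_normr normc_real ?invr_ge0 ?anorm_ge0//.
  by rewrite -rmorphM mulVf.
rewrite linearZ/= Normc.normcM normc_real ?invr_ge0 ?anorm_ge0//.
by rewrite mulrC ler_pdivrMr// mul1r.
Qed.

(** Trades continuity and the dual norm for conditions at single points, which survive convex
    combinations and pointwise limits. *)
Lemma stateP f : states f <->
  [/\ positive_functional f, f 1 = 1 & forall x, Normc.normc (f x) <= anorm x].
Proof.
split=> [sf|[pf f1 bf]].
  by have [_ pf _ f1] := sf; split=> // x; exact: state_bound.
split=> //.
- move=> x; apply/(cvgrPdist_lt (FF := nbhs_filter x)) => e e0.
  apply/nbhs_ballP; exists e => // y.
  rewrite -ball_normE /ball_/= -linearB normc_normr; apply: le_lt_trans.
  by rewrite [leRHS](_ : _ = (anorm (x - y))%:C)// lecR; exact: bf.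
- apply/eqP; rewrite eq_le; apply/andP; split.
    apply: ge_sup.
      exists (Normc.normc (f 0)), 0 => //=.
      by rewrite -(scale0r 0) -lecR anormZ normr0 mul0r.
    by move=> _ [x /= x1 <-]; exact: le_trans (bf x) x1.
  (* The value 1 is attained at the unit, which lies in the unit ball by [anorm1]. *)
  apply: ub_le_sup.
    by exists 1 => _ [x /= x1 <-]; exact: le_trans (bf x) x1.
  by exists 1; rewrite /= ?anorm1// f1 Normc.normc1.
Qed.

Lemma state_sqr_real f x : states f ->
  f (star x * x) = (complex.Re (f (star x * x)))%:C.
Proof. by move=> [_ /(_ x) + _ _] => /ger0_real /RRe_real. Qed.

Lemma convex_state f g (t : R) : states f -> states g -> 0 <= t <= 1 ->
  exists2 h : {scalar A}, states h &
    forall x, h x = t%:C * f x + (1 - t)%:C * g x.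
Proof.
move=> /stateP[pf f1 bf] /stateP[pg g1 bg] /andP[t0 t1].
have s0 : 0 <= 1 - t by rewrite subr_ge0.
pose h0 x := t%:C * f x + (1 - t)%:C * g x.
have lin : scalar h0.
  by move=> c x y; rewrite /h0 !linearP/=; ring.
pose hL := GRing.isLinear.Build R[i] A R[i] *%R h0 lin.
pose h : {scalar A} := HB.pack h0 hL.
exists h => //; apply/stateP; split=> [x||x].
- by rewrite /= /h0 addr_ge0// mulr_ge0// ler0c.
- by rewrite /= /h0 f1 g1 !mulr1 -rmorphD addrC subrK.
- apply: (le_trans (le_normcD _ _)); rewrite !Normc.normcM !normc_real//.
  have -> : anorm x = t * anorm x + (1 - t) * anorm x by ring.
  by apply: lerD; exact: ler_wpM2l.
Qed.

(* Banach-Alaoglu, with the weak* limit built coordinatewise. *)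
Lemma states_ultra_cvg (F : set_system {scalar A}) : UltraFilter F ->
  F states -> exists2 g, states g & forall x,
    ((fun f : {scalar A} => complex.Re (f x)) @ F --> complex.Re (g x)) /\
    ((fun f : {scalar A} => complex.Im (f x)) @ F --> complex.Im (g x)).
Proof.
move=> UF Fst.
have PF : ProperFilter F := @ultra_proper _ _ UF.
(* For a fixed [x], states keep the coordinate [p (f x)] in a compact segment, where the image
   ultrafilter must converge. *)
have lim (p : R[i] -> R) x : (forall z, `|p z| <= Normc.normc z) ->
    exists l : R, (fun f : {scalar A} => p (f x)) @ F --> l.
  move=> ple.
  have UpF : UltraFilter ((fun f : {scalar A} => p (f x)) @ F).
    exact: ultra_fmap.
  have FI : F ((fun f : {scalar A} => p (f x)) @^-1` `[- anorm x, anorm x]).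
    apply: filterS Fst => f sf; rewrite /= in_itv/= -ler_norml.
    exact: le_trans (ple _) (state_bound x sf).
  have := @segment_compact R (- anorm x) (anorm x).
  by rewrite compact_ultra => /(_ _ UpF FI)[l [_ ?]]; exists l.
have /choice[re Hre] := fun x => lim _ x normr_Re_le_normc.
have /choice[im Him] := fun x => lim _ x normr_Im_le_normc.
pose g0 x := re x +i* im x.
(* Linearity, real values on [star x * x] and the value at the unit all pass to the limit by
   uniqueness of limits. *)
have uniq (u : {scalar A} -> R) (l l' : R) :
    u f @[f --> F] --> l -> u f @[f --> F] --> l' -> l = l'.
  by move=> ul ul'; exact: (cvg_unique (@Rhausdorff R) ul ul').
have lin : scalar g0.
  move=> c x y; apply/eqP; rewrite eq_complex; apply/andP.
  split; apply/eqP; rewrite ?ReD ?ImD ?ReM ?ImM /=.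
    apply: uniq (Hre _) _.
    under eq_cvg do rewrite linearP/= ReD ReM.
    exact: (cvgD (cvgB (cvgM (cvg_cst _) (Hre x))
                       (cvgM (cvg_cst _) (Him x))) (Hre y)).
  apply: uniq (Him _) _.
  under eq_cvg do rewrite linearP/= ImD ImM.
  exact: (cvgD (cvgD (cvgM (cvg_cst _) (Him x))
                     (cvgM (cvg_cst _) (Hre x))) (Him y)).
pose gL := GRing.isLinear.Build R[i] A R[i] *%R g0 lin.
pose g : {scalar A} := HB.pack g0 gL.
exists g => //; apply/stateP; split=> [x||x].
- rewrite lecE/=; apply/andP; split.
    apply/eqP/(uniq _ _ _ (Him _)); apply: cvg_near_cst.
    by apply: filterS Fst => f /(state_sqr_real x) ->.
  apply: cvgr_to_ge (Hre _) _.
  apply: filterS Fst => f [_ /(_ x) + _ _].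
  by rewrite lecE => /andP[].
- apply/eqP; rewrite eq_complex; apply/andP; split; apply/eqP.
    apply: uniq (Hre _) _; apply: cvg_near_cst.
    by apply: filterS Fst => f [_ _ _ ->].
  apply: uniq (Him _) _; apply: cvg_near_cst.
  by apply: filterS Fst => f [_ _ _ ->].
(* The squared modulus is a polynomial in the two coordinates, so its limit follows from theirs. *)
- rewrite -(@ler_pXn2r _ 2) ?nnegrE ?normc_ge0 ?anorm_ge0// normc_sqr.
  have H : (fun f : {scalar A} =>
      complex.Re (f x) ^+ 2 + complex.Im (f x) ^+ 2) @ F -->
      re x ^+ 2 + im x ^+ 2.
    exact: (cvgD (cvgM (Hre x) (Hre x)) (cvgM (Him x) (Him x))).
  apply: cvgr_to_le H _; apply: filterS Fst => f sf.
  by rewrite -normc_sqr ler_pXn2r ?nnegrE ?normc_ge0 ?anorm_ge0// state_bound.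
Qed.

End states.

(** * The height function and its three properties *)

Section height.
Set Implicit Arguments.
Unset Strict Implicit.
Context {R : realType} {A : cstarAlgType R}.
Variable a : A.

Lemma Lset_state (f : {scalar A}) : states f ->
  Lset a (f a) (complex.Re (f (star a * a))).
Proof. by move=> sf; exists f => //; split=> //=; rewrite -state_sqr_real. Qed.

Lemma Lset_bounded mu : has_ubound (Lset a mu).
Proof.
exists (anorm (star a * a)) => r [f sf [_ /= fr]].
rewrite (le_trans (ler_norm r))//.
apply: le_trans (state_bound (star a * a) sf).
by rewrite fr; exact: (normr_Re_le_normc r%:C).
Qed.

Lemma le_height mu r : Lset a mu r -> r <= height a mu.
Proof. by move=> Lr; apply: ub_le_sup => //; exact: Lset_bounded. Qed.

(** Membership in [W a mu] makes the set nonempty; on the empty set [sup] would be the default 0,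
    which [c] need not dominate. *)
Lemma height_le mu c : W a mu -> ubound (Lset a mu) c -> height a mu <= c.
Proof.
move=> [f sf <-] H; apply: ge_sup => //.
by exists (complex.Re (f (star a * a))); exact: Lset_state.
Qed.

Lemma height_ge0 mu : W a mu -> 0 <= height a mu.
Proof.
move=> [f sf <-]; apply: le_trans (le_height (Lset_state sf)).
by have [_ /(_ a) + _ _] := sf; rewrite lecE => /andP[].
Qed.

Lemma height_concave : concave_on (W a) (height a).
Proof.
move=> x y t Wx Wy t01 z.
have [t0 t1] := andP t01.
have key r s : Lset a x r -> Lset a y s -> Lset a z (t * r + (1 - t) * s).
  move=> [f sf [/= fx fr]] [g sg [/= gy gs]].
  have [h sh hE] := convex_state sf sg t01.
  by exists h => //=; rewrite !hE fx fr gy gs -!rmorphM -rmorphD.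
split.
  have [f sf fx] := Wx; have [g sg gy] := Wy.
  have [h sh hE] := convex_state sf sg t01.
  by exists h => //; rewrite hE fx gy.
(* Reduces an affine bound on the supremum to a bound on the elements. Weight 0 cannot be divided
   by, and there any single element suffices. It is used once for each of the two heights. *)
have step (u w v : R) (mu : R[i]) : 0 <= w -> W a mu ->
    (forall r, Lset a mu r -> w * r + u <= v) -> w * height a mu + u <= v.
  move=> w0 Wmu H; have [w1|w1] := eqVneq w 0.
    have [f sf fmu] := Wmu.
    by have := Lset_state sf; rewrite fmu => /H; rewrite w1 !mul0r.
  have wp : 0 < w by rewrite lt_def w1.
  rewrite -lerBrDr mulrC -ler_pdivlMr//; apply: height_le => // r Lr.
  by rewrite ler_pdivlMr// mulrC lerBrDr; exact: H.
apply: (step) => // r Lr; rewrite addrC.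
apply: (step); rewrite ?subr_ge0// => s Ls.
by rewrite addrC; apply: le_height; exact: key.
Qed.

Lemma height_usc : upper_semicontinuous_on (W a) (height a).
Proof.
move=> x c Wx hxc.
(* The midpoint leaves two strict gaps: [c' < c] yields the strict bound near [x], and
   [height a x < c'] yields the final contradiction. *)
pose c' := (height a x + c) / 2.
have [hc' c'c] : height a x < c' /\ c' < c by rewrite /c'; split; lra.
pose S e : set {scalar A} := [set f | [/\ states f, Normc.normc (f a - x) < e &
  c' <= complex.Re (f (star a * a))]].
(* If some [S e] is empty, the ball of radius [e] is the required neighbourhood: there every element
   of [Lset a y] is below [c']. *)
have [[e e0 Se]|noe] := pselect (exists2 e, 0 < e & S e = set0).
  rewrite /within/=; apply/nbhs_ballP; exists e%:C => /=.
    by rewrite ltcR.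
  move=> y xy Wy; apply: le_lt_trans c'c.
  apply: height_le => // r [f sf [/= fy fr]].
  rewrite leNgt; apply/negP => c'r.
  suff : S e f by rewrite Se.
  split=> //; last by rewrite fr ltW.
  by move: xy; rewrite -ball_normE /ball_/= distrC fy normc_normr ltcR.
(* Otherwise the nested sets [S e] generate a proper filter, and an ultrafilter refining it
   converges to a state [g]. *)
pose G := filter_from [set e : R | 0 < e] S.
have GF : ProperFilter G.
  apply: filter_from_proper; last first.
    by move=> e /= e0; apply/set0P/eqP => Se; apply: noe; exists e.
  apply: filter_from_filter; first by exists 1 => /=.
  move=> i j /= i0 j0; exists (Num.min i j) => [|f [sf + cf]].
    by rewrite /= lt_min i0.
  by rewrite lt_min => /andP[? ?]; split; split.
have [U [UU GU]] := ultraFilterLemma GF.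
have US e : 0 < e -> U (S e) by move=> e0; apply: GU; exists e.
have Ust : U states by apply: filterS (US 1 ltr01) => f [].
have [g sg gU] := states_ultra_cvg UU Ust.
have PU : ProperFilter U := @ultra_proper _ _ UU.
(* Along [U] the values at [a] tend to [x]; taking [p] to be the real and then the imaginary part
   identifies [g a] with [x]. *)
have lim (p : R[i] -> R) : (forall z, `|p z| <= Normc.normc z) ->
    (forall z1 z2, p (z1 - z2) = p z1 - p z2) ->
    (fun f : {scalar A} => p (f a)) @ U --> p x.
  move=> ple pB; apply/cvgrPdist_lt => e e0.
  apply: filterS (US e e0) => f [_ fe _].
  by rewrite distrC -pB; exact: le_lt_trans (ple _) fe.
have gx : g a = x.
  apply/eqP; rewrite eq_complex; apply/andP; split; apply/eqP.
    apply: (cvg_unique (@Rhausdorff R) (gU a).1).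
    by apply: (lim (@complex.Re R)); [exact: normr_Re_le_normc|case=> ? ? []].
  apply: (cvg_unique (@Rhausdorff R) (gU a).2).
  by apply: (lim (@complex.Im R)); [exact: normr_Im_le_normc|case=> ? ? []].
have /le_height := Lset_state sg; rewrite gx => gh.
suff : c' <= height a x by rewrite leNgt hc'.
apply: le_trans gh; apply: cvgr_to_ge (gU (star a * a)).1 _.
by apply: filterS (US 1 ltr01) => f [].
Qed.

End height.

Theorem theorem2p14 (R : realType) (A : cstarAlgType R) (a : A) :
  [/\ forall mu : R[i], W a mu -> 0 <= height a mu,
      concave_on (W a) (height a)
    & upper_semicontinuous_on (W a) (height a)].
Proof.
split; [exact: height_ge0|exact: height_concave|exact: height_usc].
Qed.
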